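(* Let $K,i,\kappa$ be positive integers and $\epsilon\in\{0,1\}$ such that $K>2$, $K=2\kappa-\epsilon$ and $1\le i\le\kappa$. For an integer $n\ge0$ let $P_{K,i}(2n)$ be the number of lattice paths of weight $2n$ that start at $(0,2\kappa-2i)$, have all peaks of height not larger than $K-1$, and have all peaks at even $x$ positions. Let $E_{K,i}(2n)$ be the number of partitions $(p_1,\dots,p_m)$, $p_1\ge\cdots\ge p_m\ge1$ (with any number $m\ge 0$ of parts), of $2n$ such that every odd part occurs an even number of times, $p_l\ge p_{l+K-1}+2$ for all $1\le l\le m-K+1$, and there are at most $2i-2$ parts equal to $1$. Then $$P_{K,i}(2n)=E_{K,i}(2n).$$
   Context: **Lattice paths.** Paths are in the first quadrant of the integer square lattice. A path starts at a point $(0,a)$ with $a$ an even non-negative integer. The allowed steps are: from $(x,y)$ to $(x+1,y+1)$; from $(x,y)$ to $(x+1,y-1)$ if $y\ge1$; and from $(x,0)$ to $(x+1,0)$. A non-empty path ends on the $x$ axis with a step from $(x,1)$ to $(x+1,0)$; the empty path (no steps) is allowed only for $a=0$. A peak is a vertex preceded by a step $(+1,+1)$ and followed by a step $(+1,-1)$ (the starting vertex is never a peak); the height of a peak is its $y$ coordinate. The weight of a path is the sum of the $x$ coordinates of all its peaks. *)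

(* Defs.v *)
From mathcomp Require Import all_boot.
From mathcomp Require Import finmap.
From mathcomp Require Import classical_sets cardinality.

Set Implicit Arguments.
Unset Strict Implicit.
Unset Printing Implicit Defensive.

Local Open Scope classical_set_scope.
Local Open Scope nat_scope.

(* The coordinates are in nat, so that paths stay in the first quadrant. *)
Definition point := (nat * nat)%type.

Definition up_step (p q : point) : bool := q == (p.1.+1, p.2.+1).
Definition down_step (p q : point) : bool :=
  (0 < p.2) && (q == (p.1.+1, p.2.-1)).
Definition flat_step (p q : point) : bool :=
  (p.2 == 0) && (q == (p.1.+1, 0)).
Definition lattice_step (p q : point) : bool :=
  [|| up_step p q, down_step p q | flat_step p q].

(* A path is the sequence of all its vertices, starting point included; the
   empty path (no steps) is thus [:: (0, 0)]. *)
Definition lattice_path (a : nat) (v : seq point) : bool :=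
  if v is p :: s then
    [&& p == (0, a), path lattice_step p s &
        if s is [::] then a == 0
        else (* the last step is from (x, 1) to (x + 1, 0) *)
          ((last p (belast p s)).2 == 1) && ((last p s).2 == 0)]
  else false.

Fixpoint peaks (v : seq point) : seq point :=
  if v is u :: v' then
    (if v' is p :: q :: _ then
       if up_step u p && down_step p q then [:: p] else [::]
     else [::]) ++ peaks v'
  else [::].

Definition weight (v : seq point) : nat := \sum_(p <- peaks v) p.1.

Definition counted_paths (K a w : nat) : set (seq point) :=
  [set v | [/\ lattice_path a v, weight v = w,
               {in peaks v, forall p, p.2 <= K - 1} &
               {in peaks v, forall p, ~~ odd p.1}]].

Definition is_partition (N : nat) (p : seq nat) : Prop :=
  [/\ sorted geq p, 0 \notin p & sumn p = N].

(* nth 0 p l is the part p_(l+1), the parts being numbered from 1 in the usual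
   notation for partitions. *)
Definition counted_partitions (K i N : nat) : set (seq nat) :=
  [set p | [/\ is_partition N p,
               forall x, odd x -> ~~ odd (count_mem x p),
               forall l, l + (K - 1) < size p ->
                 nth 0 p (l + (K - 1)) + 2 <= nth 0 p l &
               count_mem 1 p <= 2 * i - 2]].

(* fset_set is only meaningful on finite sets: see finite_counted_paths and
   finite_counted_partitions below. *)
Definition nb_paths (K a w : nat) : nat := #|` fset_set (counted_paths K a w)|.
Definition nb_partitions (K i N : nat) : nat := #|` fset_set (counted_partitions K i N)|.

Lemma finite_bounded_seq (T : choiceType) (A : set T) (N : nat) :
  finite_set A ->
  finite_set [set s : seq T | size s <= N /\ forall x, x \in s -> A x].
Proof.
move=> finA; elim: N => [|N IHN].
  apply: (@sub_finite_set _ _ [set [::]]) => // s [].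
  by rewrite leqn0 size_eq0 => /eqP ->.
apply: (@sub_finite_set _ _ ([set [::]] `|`
  [set x :: s | x in A & s in [set s : seq T | size s <= N /\
                                 forall x, x \in s -> A x]])).
  case=> [|x s] [/= szs sA]; first by left.
  right; exists x; first by apply: sA; rewrite mem_head.
  exists s => //; split=> // y ys; apply: sA.
  by rewrite inE ys orbT.
by rewrite finite_setU; split=> //; apply: finite_image2.
Qed.

Lemma finite_lt (B : nat) : finite_set [set x : nat | x < B].
Proof. exact: finite_II. Qed.

Lemma finite_counted_partitions (K i N : nat) : finite_set (counted_partitions K i N).
Proof.
apply: sub_finite_set (finite_bounded_seq N (finite_lt N.+1)).
move=> p [[_ p0 pN] _ _ _] /=; rewrite -pN {pN}; split.
  elim: p p0 => //= x p IHp; rewrite inE negb_or => /andP[x0 /IHp szp].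
  by rewrite -add1n leq_add // lt0n eq_sym.
move=> x; elim: p {p0} => //= y p IHp; rewrite inE => /orP[/eqP->|/IHp].
  by rewrite ltnS leq_addr.
by rewrite !ltnS => /leq_trans; apply; rewrite leq_addl.
Qed.

Lemma path_size_bound (a M : nat) (s : seq point) (p : point) :
    path lattice_step p s -> s != [::] ->
    (last p (belast p s)).2 = 1 -> (last p s).2 = 0 ->
    {in peaks (p :: s), forall q, q.1 <= M} -> p.2 <= p.1 + a ->
  if down_step p (head p s) then p.1 + size s <= maxn (p.1 + p.2) (2 * M + a)
  else p.1 + size s <= 2 * M + a.
Proof.
elim: s p => // q s IHs p.
case: s IHs => [|r s] IHs.
  case: p => x y; case: q => x' y' /= /andP[+ _] _ y1 y'0.
  rewrite {}y1 {}y'0 /lattice_step /up_step /down_step /flat_step /= !xpair_eqE /=.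
  by rewrite andbF andbT orbF /= => -> _ _; rewrite leq_max leqnn.
move=> /=/andP[pq qrs] _ pen lst pks ypa.
have ppks x : x \in peaks (q :: r :: s) -> x.1 <= M.
  by move=> xq; apply: pks; rewrite mem_cat xq orbT.
have qya : q.2 <= q.1 + a.
  case/or3P: pq => [/eqP->|/andP[_ /eqP->]|/andP[_ /eqP->]] //=.
  by rewrite addSn leqW // (leq_trans (leq_pred _)).
have {IHs ppks} := IHs q qrs isT pen lst ppks qya.
have -> : q.1 = p.1.+1.
  by case/or3P: pq => [/eqP->|/andP[_ /eqP->]|/andP[_ /eqP->]].
rewrite addSnnS -[(size s).+2]/(size (q :: r :: s)) [head q _]/=.
case/or3P: pq => [pq|pq|pq].
- have -> : down_step p q = false.
    rewrite /down_step (eqP pq) xpair_eqE /= eqxx.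
    by case: (p.2) => //= m; rewrite gtn_eqF // ltnW.
  case: ifP => // qr.
  have qM : q.1 <= M by apply: pks; rewrite pq qr mem_head.
  move=> /leq_trans; apply; rewrite geq_max leqnn andbT.
  have -> : p.1.+1 = q.1 by rewrite (eqP pq).
  by rewrite mul2n -addnn -addnA leq_add // (leq_trans qya) // leq_add2r.
- rewrite pq; case/andP: pq => p0 /eqP -> /=.
  case: ifP => _; first by rewrite addSnnS prednK.
  by rewrite leq_max => ->; rewrite orbT.
- case/andP: pq => p0 /eqP ->.
  by rewrite /down_step /= (eqP p0).
Qed.

Lemma finite_counted_paths (K a w : nat) : finite_set (counted_paths K a w).
Proof.
set B := 2 * w + a.
have fin2 : finite_set ([set x | x < B.+1] `*` [set y | y < (a + B).+1]).
  by apply: finite_setX; apply: finite_lt.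
apply: sub_finite_set (finite_bounded_seq B.+1 fin2).
move=> v [+ wv _ _]; case: v wv => // p s wv /and3P[/eqP pE ps pend].
have szs : size s <= B.
  case: s wv ps pend => // q s wv ps /andP[/eqP pen /eqP lst].
  have wM : {in peaks (p :: q :: s), forall r, r.1 <= w}.
    by move=> r rpk; rewrite -wv /weight (big_rem r) //= leq_addr.
  have := path_size_bound (a := a) ps isT pen lst wM.
  rewrite pE /= !add0n => /(_ (leqnn _)).
  case: ifP => // _ /leq_trans; apply.
  by rewrite geq_max leqnn andbT leq_addl.
split=> //= x; rewrite !ltnS.
have {pend wv} : p.1 + size s <= B /\ p.2 + size s <= a + B.
  by rewrite pE add0n leq_add2l.
move: (B) (a + B) => B1 B2 {szs pE}.
elim: s p ps => [|q s IHs] p /=.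
  by move=> _; rewrite !addn0 mem_seq1 => -[? ?] /eqP->.
move=> /andP[pq qs] [h1 h2]; rewrite in_cons => /orP[/eqP->|].
  by split; [apply: leq_trans h1|apply: leq_trans h2]; rewrite leq_addr.
apply: IHs => //.
have [q1 q2] : q.1 = p.1.+1 /\ q.2 <= p.2.+1.
  case/or3P: pq => [/eqP->|/andP[_ /eqP->]|/andP[_ /eqP->]] //=.
  by split=> //; rewrite leqW // leq_pred.
rewrite q1 addSnnS; split=> //; apply: leq_trans h2.
by rewrite -addSnnS leq_add2r.
Qed.

(* Main.v *)
From mathcomp Require Import finmap classical_sets cardinality zify.
Require Import Defs.
From mathcomp Require Import all_boot.

Set Implicit Arguments.
Unset Strict Implicit.
Unset Printing Implicit Defensive.

(** The two families are matched by the Burge correspondence, which is seen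
here to turn the parity of the positions of the peaks into the parity of the
multiplicities of the odd parts.

Encode a partition by its multiplicities [f_1, f_2, ...] and put f_0 = a, the
height of the starting point.  Cover the support of f greedily, starting from
the largest index, by disjoint pairs (j, j+1) with f_(j+1) > 0, and move one
unit from j+1 to j in each pair; a last pair (-1, 0) just makes f_0 decrease.
The path goes up when (0, 1) is one of the pairs, and otherwise goes down, or
flat if f_0 = 0.  Iterating until f vanishes reads off a path; f_0 is always
the current height.  This is reversible: after a move every pair has a positive
lower entry, so the pairs are recovered greedily from the smallest index.  The
reversed move is [raise], and [freqs] folds it over a path, from the end to
the beginning; it is a bijection from the paths starting at height a onto all
multiplicity sequences ([freqs_inj], [freqs_surj]).

Let N be the number of pairs (j, j+1) with j >= 0.
- N is the number of peaks of the path ([npairs_freqs]).  A move lowers the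
  weight of the partition by N; cutting off the first step of a path translates
  it by one and lowers its weight by its number of peaks.  Hence the weights
  agree ([weight_freqs]).
- Each pair has exactly one odd index, whose entry changes parity in a move.  So
  if O counts the odd indices with an odd entry, O before plus O after a move
  is N.  Cutting off the first step of a path exchanges the peaks at odd and at
  even positions, so the number of peaks at odd positions obeys the same rule,
  and equals O ([odd_peaks_freqs]).
- A move preserves the bound f_j + f_(j+1) <= K - 1 for all j >= 0, as long as
  f_0 <= K - 1; along the path it amounts to the bound on the heights of the
  peaks ([adj_freqs]).  For j = 0 it bounds the number of parts 1 by
  K - 1 - a, and for j > 0 it is the difference condition at distance K - 1
  ([gap_condition]). *)

(** * Frequency sequences and the elementary move *)

(** A list g holds the entries of f at the indices k, k+1, ..., where k = 1 at
the outset.  The flag c tells that the entry just before g is the lower end of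
a pair, so that the first entry of g has to receive a unit.  Greedy pairing
from the smallest index only needs this one bit of memory. *)
Fixpoint raise (c : bool) (g : seq nat) : seq nat :=
  if g is x :: t then
    if c then x.+1 :: raise false t
    else if x is y.+1 then y :: raise true t else 0 :: raise false t
  else if c then [:: 1] else [::].

(** The number of pairs whose lower end lies in g, met by [raise] run with the
same flag. *)
Fixpoint npairs (c : bool) (g : seq nat) : nat :=
  if g is x :: t then
    if c then npairs false t
    else if x is y.+1 then (npairs true t).+1 else npairs false t
  else 0.

(** No trailing zeros: the default value 1 makes the empty list canonical. *)
Definition canonical (g : seq nat) : bool := last 1 g != 0.

Lemma canonical_tail x t : canonical (x :: t) -> canonical t.
Proof. by case: t. Qed.

Lemma canonical_cons x t :
  canonical t -> (x != 0) || (t != [::]) -> canonical (x :: t).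
Proof. by case: t => //= _; rewrite orbF. Qed.

Lemma canonical_raise c g : canonical g -> canonical (raise c g).
Proof.
elim: g c => [|x t IH] [] // cg; have ct := canonical_tail cg.
  by apply: (@canonical_cons x.+1); first exact: IH.
case: x cg => [|x] cg; last first.
  by apply: (@canonical_cons x); [exact: IH | case: (t) => *; rewrite orbT].
apply: (@canonical_cons 0); first exact: IH.
by case: t cg {IH ct} => // -[].
Qed.

(** Prepends an entry, keeping lists canonical: a final 1 that loses its unit has
to disappear. *)
Definition trim (y : nat) (t : seq nat) : seq nat :=
  if (y == 0) && nilp t then [::] else y :: t.

(** The inverse of [raise], pairing greedily from the largest index.  The boolean
tells that the first entry of the list was the upper end of a pair whose lower
end is the entry before the list. *)
Fixpoint unraise (g : seq nat) : bool * seq nat :=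
  if g is x :: t then
    let: (c, t') := unraise t in
    if c then (false, x.+1 :: t')
    else if x is y.+1 then (true, trim y t') else (false, 0 :: t')
  else (false, [::]).

Lemma raiseK c g : canonical g -> unraise (raise c g) = (c, g).
Proof.
elim: g c => [|x t IH] [] // cg; have /IH {}IH := canonical_tail cg.
- rewrite /= IH /trim; case: t cg {IH} => [|y t]; last by rewrite andbF.
  by case: x.
- by case: x cg => [|x] _ /=; rewrite IH.
Qed.

Lemma unraiseK g : canonical g ->
  canonical (unraise g).2 /\ raise (unraise g).1 (unraise g).2 = g.
Proof.
elim: g => // x t IH cg; have /IH {IH} := canonical_tail cg.
rewrite [unraise (x :: t)]/=; case: (unraise t) => -[] t' /= [ct' tE].
  by rewrite tE; split=> //; case: t' ct' {tE}.
case: x cg => [|x] cg /=.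
  by rewrite tE; split=> //; case: t' ct' tE cg => //= _ <-.
rewrite /trim; case: t' ct' tE => [|z t'] ct' tE.
  by case: x cg => [|x] /= _; rewrite -tE.
by rewrite andbF /= -tE; split.
Qed.

(** Pairing from the left needs the same number of pairs before and after a move,
up to the pair whose upper end is the first entry and whose lower end precedes
the list.  The last two equations are what the induction needs when the entry
before the list is the lower end of a pair on the left-hand side, so that the
first entry is already covered. *)
Lemma npairs_raise g :
  [/\ npairs false (raise false g) = npairs false g,
      npairs false (raise true g) = (npairs true g).+1,
      npairs true (raise false g) = npairs false g &
      npairs true (raise true g) = npairs true g].
Proof.
elim: g => [|x t [IHff IHft IHtf IHtt]] //=; split; rewrite ?IHff ?IHtf //.
  by case: x => [|[|x]] /=; rewrite ?IHff ?IHft ?IHtt.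
by case: x => [|x] /=; rewrite ?IHff ?IHft.
Qed.

Lemma npairs_gt0 g : canonical g -> (g == [::]) || (0 < npairs false g).
Proof.
elim: g => // -[|x] t IH cg //=.
by have := IH (canonical_tail cg); case: t cg {IH}.
Qed.

Fixpoint freq_weight (k : nat) (g : seq nat) : nat :=
  if g is x :: t then k * x + freq_weight k.+1 t else 0.

(** A unit moved inside a pair gains 1, and the unit received from index k - 1 is
not accounted for in g, so that it gains k. *)
Lemma freq_weight_raise_aux c k g :
  freq_weight k (raise c g) = freq_weight k g + npairs c g + c * k.
Proof.
elim: g c k => [|x t IH] [] k /=; rewrite ?muln1 //; try lia.
  by rewrite IH; nia.
by case: x => [|x] /=; rewrite IH; nia.
Qed.

(** At k = 1 the unit received from the index 0 counts for the additional pair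
(0, 1), and the flag disappears from the formula. *)
Lemma freq_weight_raise c g :
  freq_weight 1 (raise c g) = freq_weight 1 g + npairs false (raise c g).
Proof.
rewrite freq_weight_raise_aux; have [] := npairs_raise g.
by case: c => h1 h2 _ _; rewrite ?h1 ?h2; lia.
Qed.

Fixpoint nb_odd (k : nat) (g : seq nat) : nat :=
  if g is x :: t then (odd k && odd x) + nb_odd k.+1 t else 0.

(** Exactly one of j and j + 1 is odd and the parity of its entry is flipped: it is
odd either before or after the move.  The flag adds the same for the pair
(k - 1, k), of which only the index k belongs to g. *)
Lemma nb_odd_raise_aux c k g :
  nb_odd k (raise c g) + nb_odd k g = npairs c g + c * odd k.
Proof.
elim: g c k => [|x t IH] [] k /=; rewrite ?andbT ?mul1n; try lia.
  by have := IH false k.+1; case: (odd k) => /=; case: (odd x) => /=; lia.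
case: x => [|x] /=; first by have := IH false k.+1; lia.
by have /= := IH true k.+1; case: (odd k) => /=; case: (odd x) => /=; lia.
Qed.

Lemma nb_odd_raise c g :
  nb_odd 1 (raise c g) + nb_odd 1 g = npairs false (raise c g).
Proof.
rewrite nb_odd_raise_aux; have [] := npairs_raise g.
by case: c => h1 h2 _ _; rewrite ?h1 ?h2 /=; lia.
Qed.

Definition adj (M b : nat) (g : seq nat) : bool := path (fun x y => x + y <= M) b g.

(** Inside a pair the sum is constant.  Between two pairs that are adjacent, the
upper end of the first gains a unit and the lower end of the second loses one.
If a zero separates them, the sums at stake are bounded by entries of a pair.
The first entry b plays the role of f_0: it gives its unit to g in the first
equation, and is the height before a down or flat step in the second. *)
Lemma adj_raise M g :
  (forall b, adj M b (raise true g) = (b < M) && adj M b.+1 g) /\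
  (forall b, b <= M -> adj M b (raise false g) = adj M b.-1 g).
Proof.
rewrite /adj; elim: g => [|x t [IHt IHf]] /=.
  by split=> b; rewrite ?addn1 // andbT.
split=> b.
  rewrite addnS addSn; case: (ltnP (b + x) M) => h; last by rewrite andbF.
  rewrite IHf /=; last by lia.
  by have -> : b < M by lia.
case: x => [|x] /= bM; first by rewrite IHf //; case: path; lia.
by rewrite IHt; case: path; lia.
Qed.

(** * From lattice paths to frequency sequences *)

(** Down and flat steps need not be told apart: the height decides. *)
Fixpoint freqs (p : point) (s : seq point) : seq nat :=
  if s is q :: s' then raise (up_step p q) (freqs q s') else [::].

(** The condition on the last step in a form that passes to the tail of a path. *)
Fixpoint ends_down (p : point) (s : seq point) : bool :=
  if s is q :: s' then
    if s' is [::] then (p.2 == 1) && (q.2 == 0) else ends_down q s'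
  else p.2 == 0.

Lemma lattice_pathE a v :
  lattice_path a v =
    [&& head (0, 0) v == (0, a), v != [::],
        path lattice_step (head (0, 0) v) (behead v) &
        ends_down (head (0, 0) v) (behead v)].
Proof.
case: v => [|p s] /=; first by rewrite andbF.
case: eqP => // -> /=; congr (_ && _).
case: s => // q s; move: (0, a) => {}p.
by elim: s p q => // r s IHs p q; have /= <- := IHs q r.
Qed.

Lemma ends_down_tail p q s : ends_down p (q :: s) -> ends_down q s.
Proof. by case: s => //= /andP[]. Qed.

Lemma lattice_stepE p q : lattice_step p q ->
  q = (p.1.+1, if up_step p q then p.2.+1 else p.2.-1).
Proof.
rewrite /lattice_step; case: ifP => /= [/eqP //|_].
by case/orP=> [/andP[_ /eqP]|/andP[/eqP -> /eqP]].
Qed.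

Lemma canonical_freqs p s : canonical (freqs p s).
Proof. by elim: s p => //= q s IHs p; apply: canonical_raise. Qed.

(** After an up step the height is positive, so that a step that is not up is
down; and the path cannot stop there. *)
Lemma peaks_cons p q s : path lattice_step p (q :: s) -> ends_down p (q :: s) ->
  peaks (p :: q :: s) =
    (if up_step p q && ~~ up_step q (head q s) then [:: q] else [::]) ++ peaks (q :: s).
Proof.
case: s => [|r s] /=.
  case/andP=> pq _ /andP[_ q0]; case: ifP => // /andP[/eqP qE _].
  by rewrite qE in q0.
case/and3P=> pq qr _ _; congr (_ ++ _); case: (boolP (up_step p q)) => //= /eqP qE.
move: qr; rewrite /lattice_step /down_step /flat_step qE /=.
case: (boolP (up_step _ r)) => [/eqP ->|_]; last by rewrite /= orbF => ->.
by rewrite xpair_eqE /= eqxx; case: eqP => //; lia.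
Qed.

(** By [npairs_raise] a down or flat step keeps the number of pairs, and an up step
adds one pair exactly if the next step is not up, that is at a peak. *)
Lemma npairs_freqs p s : path lattice_step p s -> ends_down p s ->
  size (peaks (p :: s)) = npairs false (freqs p s).
Proof.
elim: s p => // q s IHs p pqs e.
rewrite peaks_cons // size_cat IHs; last 2 first.
- by case/andP: pqs.
- exact: ends_down_tail e.
case: s e pqs {IHs} => [|r s] /= e pqs.
  case: up_step (lattice_stepE (proj1 (andP pqs))) e => //= ->.
  by rewrite andbF.
have [Hff Hft _ _] := npairs_raise (raise (up_step q r) (freqs r s)).
case: up_step => /=; rewrite ?Hff // Hft.
have [h1 h2 h3 h4] := npairs_raise (freqs r s).
by case: up_step; rewrite ?h1 ?h2 ?h3 ?h4.
Qed.

(** The positions are absolute: translating a path by p.1 adds p.1 for each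
peak. *)
Lemma weight_freqs p s : path lattice_step p s -> ends_down p s ->
  weight (p :: s) = freq_weight 1 (freqs p s) + p.1 * npairs false (freqs p s).
Proof.
elim: s p => [|q s IHs] p pqs e; first by rewrite /weight big_nil /= muln0.
have e' := ends_down_tail e; have [pq qs] := andP pqs.
have q1 : q.1 = p.1.+1 by rewrite (lattice_stepE pq).
have sz := npairs_freqs pqs e; have sz' := npairs_freqs qs e'.
have gE : freqs p (q :: s) = raise (up_step p q) (freqs q s) by [].
have wE := freq_weight_raise (up_step p q) (freqs q s); rewrite -gE in wE.
rewrite wE -{}sz /weight peaks_cons // big_cat -/(weight (q :: s)) (IHs q) //.
rewrite -sz' size_cat q1.
by case: ifP => _; rewrite ?big_nil ?big_seq1 ?q1 /=; nia.
Qed.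

(** Positions are counted relative to p.  A peak met just after p is at distance 1;
all the others change relative parity when p is replaced by the next vertex,
which matches [nb_odd_raise] as the peaks are as many as the pairs. *)
Lemma odd_peaks_freqs p s : path lattice_step p s -> ends_down p s ->
  count (fun r => odd r.1 != odd p.1) (peaks (p :: s)) = nb_odd 1 (freqs p s).
Proof.
elim: s p => // q s IHs p pqs e.
have e' := ends_down_tail e; have [pq qs] := andP pqs.
have q1 : q.1 = p.1.+1 by rewrite (lattice_stepE pq).
have sz := npairs_freqs pqs e.
have gE : freqs p (q :: s) = raise (up_step p q) (freqs q s) by [].
have oE := nb_odd_raise (up_step p q) (freqs q s); rewrite -gE -sz -IHs // in oE.
apply/eqP; rewrite -(eqn_add2r (count (fun r => odd r.1 != odd q.1) (peaks (q :: s)))).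
rewrite {}oE peaks_cons // count_cat size_cat -addnA; apply/eqP; congr (_ + _).
  by case: ifP => //= _; rewrite q1 /=; case: odd.
rewrite -(count_predC (fun r : point => odd r.1 != odd p.1)); congr (_ + _).
by apply: eq_count => r /=; rewrite q1 /=; do 2!case: odd.
Qed.

(** A path that goes up must come down later, first going through a peak. *)
Lemma has_higher_peak p q s : path lattice_step p (q :: s) ->
  ends_down p (q :: s) -> up_step p q -> has (fun r => p.2 < r.2) (peaks (p :: q :: s)).
Proof.
elim: s p q => [|r s IHs] p q pqs e upq; rewrite peaks_cons // upq.
  by move: e upq => /andP[_ q0] /eqP qE; rewrite qE in q0.
have qE : q.2 = p.2.+1 by rewrite (eqP upq).
rewrite has_cat; case: (boolP (up_step q _)) => /= uqr; last by rewrite qE leqnn.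
case/andP: pqs => _ qrs; have := IHs q r qrs (ends_down_tail e) uqr.
by apply: sub_has => x; apply: leq_ltn_trans; rewrite qE.
Qed.

(** The condition on peaks bounds all heights after the start, so that
[adj_raise] applies at each step; an up step from height M violates both
sides. *)
Lemma adj_freqs M p s : path lattice_step p s -> ends_down p s -> p.2 <= M ->
  adj M p.2 (freqs p s) = all (fun r => r.2 <= M) (peaks (p :: s)).
Proof.
elim: s p => // q s IHs p pqs e pM.
have e' := ends_down_tail e; have [pq qs] := andP pqs.
have [adjt adjf] := adj_raise M (freqs q s).
have -> : freqs p (q :: s) = raise (up_step p q) (freqs q s) by [].
have q2 : q.2 = if up_step p q then p.2.+1 else p.2.-1 by rewrite {1}(lattice_stepE pq).
case: (boolP (up_step p q)) => upq; move: q2; rewrite ?upq ?(negbTE upq) => q2; last first.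
  by rewrite adjf // -q2 IHs // ?peaks_cons ?(negbTE upq) // q2; lia.
rewrite adjt; case: (ltnP p.2 M) => pltM; last first.
  rewrite andFb; apply/esym/negbTE; rewrite -has_predC.
  have := has_higher_peak pqs e upq; apply: sub_has => r /= pr.
  by rewrite -ltnNge; apply: leq_ltn_trans pr.
have top c : all (fun r : point => r.2 <= M) (if c then [:: q] else [::]).
  by case: c => //=; rewrite q2 pltM.
by rewrite peaks_cons // all_cat top -q2 IHs ?q2.
Qed.

(** The first step is read off the sequence by [unraise].  The empty path is told
apart because a path that ends with a down step cannot be made of flat steps
only. *)
Lemma freqs_inj p s1 s2 :
  path lattice_step p s1 -> ends_down p s1 ->
  path lattice_step p s2 -> ends_down p s2 ->
  freqs p s1 = freqs p s2 -> s1 = s2.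
Proof.
(* A path from height 0 to which no part is associated has no up step. *)
have nil_nil q s : q.2 = 0 -> path lattice_step q s -> ends_down q s ->
    freqs q s = [::] -> s = [::].
  elim: s q => // r s IHs q q0 qrs e.
  have [qr rs] := andP qrs; have := lattice_stepE qr.
  have -> : freqs q (r :: s) = raise (up_step q r) (freqs r s) by [].
  case: (up_step q r) => /= rE; first by case: freqs.
  case fE : (freqs r s) => [|[|x] t] // _.
  have r0 : r.2 = 0 by rewrite rE /= q0.
  by move: (e); rewrite (IHs r r0 rs (ends_down_tail e) fE) /= q0.
elim: s1 p s2 => [|q1 s1 IHs] p [|q2 s2] // ps1 e1 ps2 e2 fE.
- by rewrite (nil_nil p (q2 :: s2)) ?(eqP e1).
- by rewrite (nil_nil p (q1 :: s1)) ?(eqP e2).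
have [pq1 qs1] := andP ps1; have [pq2 qs2] := andP ps2.
have := congr1 unraise fE; rewrite /= !raiseK ?canonical_freqs // => -[uE gE].
have qE : q1 = q2 by rewrite (lattice_stepE pq1) (lattice_stepE pq2) uE.
rewrite -{q2 uE}qE in qs2 ps2 e2 gE pq2 fE *; congr (_ :: _).
by apply: IHs gE => //; [apply: ends_down_tail e1 | apply: ends_down_tail e2].
Qed.

(** At height 0 the truncated predecessor makes the second case a flat step. *)
Lemma next_step x b c :
  let q := (x.+1, if c then b.+1 else b.-1) in
  lattice_step (x, b) q /\ up_step (x, b) q = c.
Proof.
rewrite /lattice_step /up_step /down_step /flat_step /= !xpair_eqE eqxx /=.
case: c; first by rewrite eqxx.
by case: b => [|b] //=; rewrite eqxx orbT; split=> //; apply/eqP; lia.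
Qed.

(** Undo the moves one by one.  Each lowers the weight as there is at least one
pair, until only the height is left, from which the path goes straight down. *)
Lemma freqs_surj p g : canonical g ->
  exists s, [/\ path lattice_step p s, ends_down p s & freqs p s = g].
Proof.
have [n] := ubnP (freq_weight 1 g); elim: n p g => // n IHn [x b] g gn cg.
have [->|g0] := eqVneq g [::].
  elim: b x => [|b IHb] x; first by exists [::].
  have [s [ps e fE]] := IHb x.+1.
  exists ((x.+1, b) :: s); split=> /=.
  - by rewrite ps andbT /lattice_step /down_step /= eqxx orbT.
  - by move: e; clear; case: s => //= /eqP ->.
  - by rewrite fE /up_step xpair_eqE /= eqxx /=; case: eqP => //; lia.
have [] := unraiseK cg; case: (unraise g) => c g' /= cg' gE.
have := npairs_gt0 cg; rewrite (negbTE g0) /= => N0.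
have wE := freq_weight_raise c g'; rewrite gE in wE.
pose q := (x.+1, if c then b.+1 else b.-1).
have [|s [qs e fE]] := IHn q g' _ cg'; first by lia.
have [pq uq] : lattice_step (x, b) q /\ up_step (x, b) q = c := next_step x b c.
exists (q :: s); split.
- by rewrite /= pq.
- case: s e fE {qs} => // /eqP q0 fE; move: gE g0 q0; rewrite -fE /q.
  by case: (c) => //= <-.
- by rewrite /= fE uq.
Qed.

(** * From frequency sequences to partitions *)

Fixpoint parts (k : nat) (g : seq nat) : seq nat :=
  if g is x :: t then parts k.+1 t ++ nseq x k else [::].

Lemma count_parts k g m :
  count_mem m (parts k g) = if m < k then 0 else nth 0 g (m - k).
Proof.
elim: g k => [|x t IH] k /=; first by rewrite nth_nil if_same.
rewrite count_cat IH count_nseq /= ltnS; case: (ltngtP m k) => [//|km|->] /=.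
  by rewrite addn0 -(subnSK km).
by rewrite subnn mul1n.
Qed.

Lemma parts_ge k g m : m \in parts k g -> k <= m.
Proof. by rewrite -has_pred1 has_count count_parts; case: (ltnP m k). Qed.

Lemma sumn_parts k g : sumn (parts k g) = freq_weight k g.
Proof.
by elim: g k => //= x t IH k; rewrite sumn_cat IH sumn_nseq addnC.
Qed.

Lemma geq_trans : transitive geq.
Proof. by move=> x y z /= yx zy; apply: leq_trans zy yx. Qed.

Lemma sorted_parts k g : sorted geq (parts k g).
Proof.
elim: g k => //= x t IH k; rewrite (sorted_pairwise geq_trans) pairwise_cat.
rewrite -!(sorted_pairwise geq_trans) IH /= andbC.
apply/andP; split; first by elim: x => //= -[|x] //= ->; rewrite leqnn.
by apply/allrelP => y z /parts_ge ky /nseqP[-> _]; apply: ltnW.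
Qed.

Lemma parts_inj g1 g2 :
  canonical g1 -> canonical g2 -> parts 1 g1 = parts 1 g2 -> g1 = g2.
Proof.
move=> c1 c2 pE; have nE j : nth 0 g1 j = nth 0 g2 j.
  by have := congr1 (count_mem j.+1) pE; rewrite !count_parts !subn1.
have le h1 h2 : canonical h1 -> (forall j, nth 0 h1 j = nth 0 h2 j) -> size h1 <= size h2.
  move=> ch hE; rewrite leqNgt; apply/negP => lt; case/negP: ch; apply/eqP.
  case: h1 lt hE => // x t lt hE; rewrite /= (last_nth 0) hE nth_default //.
apply: (@eq_from_nth _ 0) => [|j _]; last exact: nE.
by apply/eqP; rewrite eqn_leq !le.
Qed.

(** The head is the largest part: its multiplicity ends the list of
multiplicities, which is therefore canonical. *)
Lemma parts_surj p : sorted geq p -> 0 \notin p ->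
  exists2 g, canonical g & parts 1 g = p.
Proof.
move=> ps p0; pose g := [seq count_mem j.+1 p | j <- iota 0 (head 0 p)].
exists g; rewrite /g {g}.
  case: p ps p0 => //= x t _; rewrite inE negb_or => /andP[x0 _].
  case: x x0 => // x _; rewrite -addn1 iotaD map_cat /canonical last_cat /=.
  by rewrite add0n addn1 eqxx.
apply: (sorted_eq geq_trans _ _ (ps)); [|exact: sorted_parts|].
  by move=> x y; rewrite /= andbC -eqn_leq => /eqP.
apply/allP => m _ /=; apply/eqP; rewrite count_parts.
case: m => [|m]; first by apply/esym/count_memPn.
rewrite /= subn1 /=; case: (ltnP m (head 0 p)) => mp.
  by rewrite (nth_map 0) ?size_iota // nth_iota.
rewrite nth_default ?size_map ?size_iota //; apply/esym/count_memPn.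
apply/negP => mem; case: p ps p0 mem mp => //= x t xt _.
rewrite inE => /predU1P[<-|mt]; first by rewrite ltnn.
have := allP (order_path_min geq_trans xt) _ mt => /= mx xm.
by have := leq_trans mx xm; rewrite ltnn.
Qed.

Lemma nb_odd_eq0 k g :
  nb_odd k g = 0 <-> forall j, odd (k + j) -> ~~ odd (nth 0 g j).
Proof.
elim: g k => [|x t IH] k /=; first by split=> // _ j; rewrite nth_nil.
split.
  move=> /eqP; rewrite addn_eq0 => /andP[kx /eqP/IH tj] [|j]; rewrite ?addn0 /=.
    by move=> ok; move: kx; rewrite ok; case: odd.
  by rewrite addnS -addSn => /tj.
move=> h; have -> : nb_odd k.+1 t = 0.
  by apply/IH => j; rewrite addSn -addnS => /h.
by have := h 0; rewrite addn0 /=; case: odd => // /(_ isT); case: odd.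
Qed.

Lemma adj_nth M b g : b <= M ->
  adj M b g <-> b + nth 0 g 0 <= M /\ forall j, nth 0 g j + nth 0 g j.+1 <= M.
Proof.
rewrite /adj; elim: g b => [|x t IH] b bM /=.
  by split=> // _; rewrite addn0; split=> // j; rewrite !nth_nil.
split.
  move=> /andP[bx]; have xM : x <= M by lia.
  by move=> /(IH _ xM) [x0 tj]; split=> // -[|j] //=; apply: tj.
case=> bx h; rewrite bx; have xM : x <= M by lia.
by apply/(IH _ xM); split=> [|j]; [exact: (h 0) | exact: (h j.+1)].
Qed.

(** Both sides say that the cell in row l and column y lies in the Young diagram
of p; the right one reads the diagram by columns. *)
Lemma nth_sorted_count p l y : sorted geq p ->
  (y < nth 0 p l) = (l < count (fun x => y < x) p).
Proof.
elim: p l => [|x t IH] l xt /=; first by rewrite nth_nil.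
have ts := path_sorted xt.
case: (ltnP y x) => yx.
  by case: l => [|l] /=; rewrite ?yx // IH.
have tx := allP (order_path_min geq_trans xt).
have -> : count (fun x => y < x) t = 0.
  apply/eqP; rewrite -leqn0 leqNgt -has_count; apply/hasPn => z /tx /= zx.
  by rewrite -leqNgt; apply: leq_trans zx yx.
rewrite ltn0; case: l => [|l] /=; first by apply/negbTE; rewrite -leqNgt.
case: (ltnP l (size t)) => lt; last by rewrite nth_default.
by apply/negbTE; rewrite -leqNgt; apply: leq_trans yx; apply: tx; apply: mem_nth.
Qed.

Lemma count_two_values (p : seq nat) j :
  count (fun x => j < x) p =
    count_mem j.+1 p + count_mem j.+2 p + count (fun x => j.+2 < x) p.
Proof. by elim: p => //= x t ->; case: (ltngtP x j.+2); lia. Qed.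

(** If j+1 and j+2 occur more than M times, they occupy more than M consecutive
places, which start after the entries larger than j+2.  Conversely, a violation
at l gives M + 1 entries with values in an interval of length 1. *)
Lemma gap_condition M p : sorted geq p -> 0 \notin p ->
  (forall l, l + M < size p -> nth 0 p (l + M) + 2 <= nth 0 p l) <->
  (forall j, count_mem j.+1 p + count_mem j.+2 p <= M).
Proof.
move=> ps p0; split=> h.
  move=> j; rewrite leqNgt; apply/negP => lt.
  set l := count (fun x => j.+2 < x) p.
  have lM : l + M < count (fun x => j < x) p by rewrite count_two_values -/l; lia.
  have := h l (leq_trans lM (count_size _ _)).
  have := nth_sorted_count l j.+2 ps; rewrite -/l ltnn.
  by have := nth_sorted_count (l + M) j ps; rewrite lM; lia.
move=> l lp; have : nth 0 p (l + M) != 0.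
  by apply/eqP => n0; move: p0; rewrite -n0 mem_nth.
case E : (nth 0 p (l + M)) => [|j] // _; rewrite addn2.
have := nth_sorted_count (l + M) j ps; rewrite E ltnSn count_two_values => /esym lt.
by rewrite nth_sorted_count //; have := h j; lia.
Qed.

(** * The bijection *)

Definition burge (v : seq point) : seq nat :=
  parts 1 (freqs (head (0, 0) v) (behead v)).

Lemma burge_inj K a w : {in counted_paths K a w &, injective burge}.
Proof.
move=> [|p1 s1] [|p2 s2] /set_mem[] + _ _ _ /set_mem[] + _ _ _; rewrite !lattice_pathE ?andbF //=.
move=> /and3P[/eqP-> ps1 e1] /and3P[/eqP-> ps2 e2] /parts_inj fE.
by congr (_ :: _); apply: freqs_inj (fE _ _) => //; apply: canonical_freqs.
Qed.

(** For eps = 0 the bound on the sum of a and f_1 only gives f_1 <= 2i - 1, which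
is improved to 2i - 2 because f_1 is even. *)
Lemma counted_partitionsE K i kappa eps N g :
  0 < i -> i <= kappa -> eps = 0 \/ eps = 1 -> K = 2 * kappa - eps ->
  counted_partitions K i N (parts 1 g) <->
  [/\ freq_weight 1 g = N, nb_odd 1 g = 0 & adj (K - 1) (2 * kappa - 2 * i) g].
Proof.
move=> i0 ik eps01 KE.
have p0 : 0 \notin parts 1 g by apply/negP => /parts_ge.
have sp := sorted_parts 1 g.
have cE j : count_mem j.+1 (parts 1 g) = nth 0 g j by rewrite count_parts subn1.
have oddE : nb_odd 1 g = 0 <-> forall x, odd x -> ~~ odd (count_mem x (parts 1 g)).
  rewrite nb_odd_eq0; split=> h; first by case=> // x ox; rewrite cE; apply: h.
  by move=> j oj; rewrite -cE; apply: h.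
have bM : 2 * kappa - 2 * i <= K - 1 by lia.
have gE := gap_condition (K - 1) sp p0.
split.
  case=> [[_ _ sN] /oddE od gap one]; split=> //; first by rewrite -sumn_parts.
  apply/adj_nth => //; split; first by rewrite -cE; lia.
  by move=> j; rewrite -!cE; apply: (proj1 gE).
case=> wN od /(adj_nth _ bM)[b0 ad]; split.
- by split=> //; rewrite sumn_parts.
- exact/oddE.
- by apply/gE => j; rewrite !cE.
- have := proj1 (nb_odd_eq0 1 g) od 0 isT; rewrite cE; lia.
Qed.

Lemma image_burge K i kappa eps N :
  0 < i -> i <= kappa -> eps = 0 \/ eps = 1 -> K = 2 * kappa - eps ->
  [set burge v | v in counted_paths K (2 * kappa - 2 * i) N]%classic
  = counted_partitions K i N.
Proof.
move=> i0 ik eps01 KE; set a := 2 * kappa - 2 * i.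
have aM : a <= K - 1 by rewrite /a; lia.
have main s : path lattice_step (0, a) s -> ends_down (0, a) s ->
    counted_paths K a N ((0, a) :: s) <->
    counted_partitions K i N (parts 1 (freqs (0, a) s)).
  move=> ps e; rewrite (counted_partitionsE _ _ i0 ik eps01 KE) -/a.
  have := weight_freqs ps e; rewrite mul0n addn0 => <-.
  have := odd_peaks_freqs ps e => <-.
  have := adj_freqs ps e aM => ->.
  have lp : lattice_path a ((0, a) :: s) by rewrite lattice_pathE /= eqxx ps.
  split.
    case=> _ wN hM ev; split=> //; last by apply/allP.
    apply/eqP; rewrite -leqn0 leqNgt -has_count; apply/hasPn => r /ev /=.
    by case: odd.
  case=> wN /eqP; rewrite -leqn0 leqNgt -has_count => /hasPn od /allP hM.
  by split=> // r /od /=; case: odd.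
apply/seteqP; split=> [p [v vA <-]|p pB].
  have [lp _ _ _] := vA; move: lp vA; rewrite lattice_pathE /burge.
  case: v => [|p0 s]; rewrite ?andbF //= => /and3P[/eqP -> ps e].
  by move/(main s ps e).
have [[ps p0 _] _ _ _] := pB; have [g cg gE] := parts_surj ps p0.
have [s [pths e fE]] := freqs_surj (0, a) cg.
exists ((0, a) :: s); last by rewrite /burge /= fE.
by apply/main; rewrite ?fE ?gE.
Qed.

Theorem proposition7 (K i kappa eps n : nat)
  (K_gt0 : 0 < K) (i_gt0 : 0 < i) (kappa_gt0 : 0 < kappa)
  (eps01 : eps = 0 \/ eps = 1)
  (K_gt2 : 2 < K) (K_def : K = 2 * kappa - eps)
  (i_le_kappa : i <= kappa) :
  nb_paths K (2 * kappa - 2 * i) (2 * n) = nb_partitions K i (2 * n).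
Proof.
have finP := finite_counted_paths K (2 * kappa - 2 * i) (2 * n).
rewrite /nb_partitions -(image_burge _ i_gt0 i_le_kappa eps01 K_def).
rewrite fset_set_image // card_in_imfset //= => v1 v2.
by rewrite !in_fset_set //; apply: burge_inj.
Qed.
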